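(* Let $A\in\mathbb{M}_n(\mathbb{C})$. If $A$ is normal (i.e. $AA^*=A^*A$) or $AA^{\mathrm{cep}}=A^{\mathrm{cep}}A$, then $A$ is CEPD.
   Context: $\mathbb{M}_n(\mathbb{C})$ is the algebra of $n\times n$ complex matrices; $^*$ is conjugate transpose; $\mathcal{R}(\cdot)$ is column space; $A^0=I$. The index $\mathrm{ind}(A)$ is the smallest integer $k\ge 0$ with $\mathrm{rank}(A^k)=\mathrm{rank}(A^{k+1})$. With $k=\mathrm{ind}(A)$, the Drazin inverse $A^D$ is the unique $X$ with $AX=XA$, $XAX=X$, $XA^{k+1}=A^k$. The core EP inverse of $A$, denoted here $A^{\mathrm{cep}}$, is the unique $X\in\mathbb{M}_n(\mathbb{C})$ with $XAX=X$ and $\mathcal{R}(X)=\mathcal{R}(A^k)=\mathcal{R}(X^* )$. $A$ is called core EP Drazin (CEPD) if $A^{\mathrm{cep}}A^D=A^DA^{\mathrm{cep}}$. *)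

(* Defs.v *)
From mathcomp Require Import all_boot all_order all_algebra.
From mathcomp Require Import complex reals.

Set Implicit Arguments.
Unset Strict Implicit.
Unset Printing Implicit Defensive.

Import Order.TTheory GRing.Theory Num.Theory.
Local Open Scope ring_scope.
Local Open Scope sesquilinear_scope.

Section ColumnSpace.
Variable F : fieldType.

(* The library's subspace relations concern row spaces, hence the transposes. *)
Definition same_colspace m n p (A : 'M[F]_(m, n)) (B : 'M[F]_(m, p)) : bool :=
  (A^T == B^T)%MS.

Lemma colspace_subP m n p (A : 'M[F]_(m, n)) (B : 'M[F]_(m, p)) :
  (A^T <= B^T)%MS <-> exists Y, A = B *m Y.
Proof.
split=> [/submxP[Y /(congr1 trmx)]|[Y ->]].
  by rewrite trmxK trmx_mul trmxK; exists Y^T.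
by rewrite trmx_mul submxMl.
Qed.

Lemma same_colspaceP m n p (A : 'M[F]_(m, n)) (B : 'M[F]_(m, p)) :
  same_colspace A B <->
  forall v : 'cV[F]_m, (exists u, v = A *m u) <-> (exists w, v = B *m w).
Proof.
split=> [/andP[/colspace_subP[Y AY] /colspace_subP[Z BZ]] v|AB].
  split=> -[u ->]; first by exists (Y *m u); rewrite AY mulmxA.
  by exists (Z *m u); rewrite BZ mulmxA.
apply/andP; split; apply/row_subP => i; rewrite -tr_col colE; apply/colspace_subP.
  by apply/AB; exists (delta_mx i 0).
by apply/AB; exists (delta_mx i 0).
Qed.

End ColumnSpace.

Section Index.
Variables (F : fieldType) (n : nat).
Implicit Type A : 'M[F]_n.

Lemma mxindex_exists A : exists k, \rank (A ^+ k) == \rank (A ^+ k.+1).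
Proof.
have rk_le k : (\rank (A ^+ k.+1) <= \rank (A ^+ k))%N.
  by rewrite exprS; exact: mxrankM_maxr.
have [/existsP[k kP]|/existsPn no] := boolP
  [exists k : 'I_n.+1, \rank (A ^+ k) == \rank (A ^+ k.+1)]; first by exists k.
have H k : (k <= n.+1)%N -> (\rank (A ^+ k) + k <= n)%N.
  elim: k => [|k IH] kn; first by rewrite addn0 rank_leq_row.
  apply: leq_trans (IH (ltnW kn)); rewrite addnS ltn_add2r ltn_neqAle rk_le andbT.
  by rewrite eq_sym; exact: (no (Ordinal kn)).
by have := H n.+1 (leqnn _); rewrite addnS ltnNge leq_addl.
Qed.

Definition mxindex A : nat := ex_minn (mxindex_exists A).

Lemma rank_mxindex A : \rank (A ^+ mxindex A) = \rank (A ^+ (mxindex A).+1).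
Proof. by rewrite /mxindex; case: ex_minnP => k /eqP. Qed.

Lemma mxindex_row A j : exists Y, A ^+ mxindex A = Y *m A ^+ (mxindex A + j).
Proof.
have sub1 : (A ^+ (mxindex A).+1 <= A ^+ mxindex A)%MS.
  by rewrite exprS; exact: submxMl.
have /submxP[Y YE] : (A ^+ mxindex A <= A ^+ (mxindex A).+1)%MS.
  by rewrite -(geq_leqif (mxrank_leqif_sup sub1)) rank_mxindex.
elim: j => [|j [Z ZE]]; first by exists 1%:M; rewrite addn0 mul1mx.
exists (Z *m Y); rewrite {1}ZE -mulmxA; congr (_ *m _).
by rewrite addnS -addSn !exprD -!mulmxE [in LHS]YE mulmxA.
Qed.

End Index.

Lemma trmxX (F : fieldType) n (A : 'M[F]_n) k : (A^T) ^+ k = (A ^+ k)^T.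
Proof.
elim: k => [|k IH]; first by rewrite !expr0 trmx1.
by rewrite exprS IH exprSr -!mulmxE trmx_mul.
Qed.

Lemma mxindex_tr (F : fieldType) n (A : 'M[F]_n) : mxindex A^T = mxindex A.
Proof.
rewrite /mxindex; case: ex_minnP => k kP kmin; case: ex_minnP => l lP lmin.
apply/eqP; rewrite eqn_leq; apply/andP; split.
  by apply: kmin; rewrite !trmxX !mxrank_tr.
by apply: lmin; move: kP; rewrite !trmxX !mxrank_tr.
Qed.

Section Inverses.
Variables (C : numClosedFieldType) (n : nat).
Implicit Types A X : 'M[C]_n.

Lemma mxindex_col A j : exists Z, A ^+ mxindex A = A ^+ (mxindex A + j) *m Z.
Proof.
have [Y] := mxindex_row A^T j; rewrite mxindex_tr !trmxX => /(congr1 trmx).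
by rewrite trmx_mul !trmxK; exists Y^T.
Qed.

Definition is_drazin A X : bool :=
  [&& A *m X == X *m A, X *m A *m X == X &
      X *m A ^+ (mxindex A).+1 == A ^+ mxindex A].

Lemma drazin_exists A : exists X, is_drazin A X.
Proof.
set k := mxindex A; rewrite /is_drazin -/k.
have [Y] := mxindex_row A k.+1; have [Z] := mxindex_col A k.+1.
have AP : A *m A ^+ k = A ^+ k *m A by rewrite !mulmxE -exprS -exprSr.
have BE : A ^+ (k + k.+1) = A ^+ k *m A *m A ^+ k.
  by rewrite !mulmxE -exprSr -exprD addSnnS.
rewrite -/k BE exprS -mulmxE; move: (A ^+ k) AP => P AP {BE}.
have [B defB] : exists B, B = P *m A *m P by exists (P *m A *m P).
rewrite -defB => PZ PY; have [G BGB] : exists G, B *m G *m B = B.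
  by exists (pinvmx B); rewrite mulmxKpV.
have PGB : P *m G *m B = P.
  by rewrite [X in X *m G]PY -!(mulmxA Y) BGB -PY.
have BGP : B *m G *m P = P by rewrite [in LHS]PZ mulmxA BGB -PZ.
have AB : A *m B = B *m A by rewrite defB !mulmxA AP -!mulmxA AP.
exists (P *m G *m P); apply/and3P; split; apply/eqP.
- transitivity (A *m P *m Z).
    by rewrite {2}PZ !mulmxA -[in RHS]PGB !mulmxA.
  transitivity (Y *m P *m A); last by rewrite -{1}BGP {2}PY !mulmxA.
  by rewrite AP [X in X *m A]PY -!mulmxA (mulmxA B) -AB -[A *m B *m Z]mulmxA -PZ AP.
- transitivity (P *m G *m B *m G *m P); first by rewrite defB !mulmxA.
  by rewrite PGB.
- transitivity (P *m G *m B); last by rewrite PGB.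
  by rewrite defB !mulmxA.
Qed.

Lemma drazin_uniq A X Y : is_drazin A X -> is_drazin A Y -> X = Y.
Proof.
set k := mxindex A.
have aux U V : is_drazin A U -> is_drazin A V -> U = A ^+ k *m V ^+ k.+1.
  move=> /and3P[/eqP Uc /eqP UAU /eqP UA] /and3P[/eqP Vc /eqP VAV /eqP VA].
  rewrite -/k in UA VA; rewrite !mulmxE in Uc UAU UA Vc VAV VA *.
  have Upow j : U = U ^+ j.+1 * A ^+ j.
    elim: j => [|j IH]; first by rewrite expr1 expr0 mulr1.
    transitivity (U ^+ j * (U * A * U) * A ^+ j); first by rewrite UAU -exprSr.
    by rewrite -(mulrA U) Uc 2!exprSr exprS !mulrA.
  have Vpow j : A ^+ k = A ^+ (k + j) * V ^+ j.
    elim: j => [|j IH]; first by rewrite addn0 expr0 mulr1.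
    have cV : GRing.comm V (A ^+ k.+1) by apply: commrX; rewrite /GRing.comm Vc.
    transitivity (A ^+ j * (A ^+ k.+1 * V) * V ^+ j).
      by rewrite -cV VA -exprD addnC.
    by rewrite mulrA -exprD -mulrA -exprS addnS -addSn addnC.
  have UAm j : U ^+ j * A ^+ (k + j) = A ^+ k.
    elim: j => [|j IH]; first by rewrite addn0 expr0 mul1r.
    by rewrite exprSr addnS -addSn exprD -mulrA (mulrA U) UA -exprD.
  by rewrite {1}(Upow k) {1}(Vpow k.+1) mulrA UAm.
move=> XD YD; rewrite (aux _ _ XD YD) -(aux _ _ YD YD) //.
Qed.

Definition drazin A : 'M[C]_n := xchoose (drazin_exists A).

Lemma drazinP A : is_drazin A (drazin A).
Proof. exact: xchooseP. Qed.

Definition is_core_ep A X : bool :=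
  [&& X *m A *m X == X, same_colspace X (A ^+ mxindex A) &
      same_colspace (A ^+ mxindex A) (X ^t*)].

Lemma mulmx_ctr m p q (M : 'M[C]_(m, p)) (N : 'M[C]_(p, q)) :
  (M *m N) ^t* = N ^t* *m M ^t*.
Proof. by rewrite trmx_mul map_mxM. Qed.

Lemma ctrmx_mul_eq0 m p (M : 'M[C]_(m, p)) : M ^t* *m M = 0 -> M = 0.
Proof.
move=> M0; apply/matrixP => i j; rewrite mxE.
have /eqP := congr1 (fun N : 'M_p => N j j) M0; rewrite !mxE psumr_eq0.
  move=> /allP/(_ i); rewrite mem_index_enum => /(_ isT).
  by rewrite !mxE mulrC -normCK expf_eq0 normr_eq0 => /eqP.
by move=> l _; rewrite !mxE mulrC -normCK exprn_ge0.
Qed.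

Lemma gram_row m p (P : 'M[C]_(m, p)) : exists Y, P = Y *m (P ^t* *m P).
Proof.
apply/submxP; rewrite submxE; apply/eqP/ctrmx_mul_eq0.
by rewrite mulmx_ctr -mulmxA (mulmxA (P ^t*)) mulmx_coker mulmx0.
Qed.

Lemma core_ep_exists A : exists X, is_core_ep A X.
Proof.
rewrite /is_core_ep; set k := mxindex A.
have AP : A *m A ^+ k = A ^+ k *m A by rewrite !mulmxE -exprS -exprSr.
have [Y2] := mxindex_row A 1; have [Q] := mxindex_col A 1.
rewrite -/k addn1 exprS -mulmxE; move: (A ^+ k) AP => P AP PQ PY2.
have [Y1 PY1] := gram_row P.
have [W defW] : exists W, W = P ^t* *m A *m P by exists (P ^t* *m A *m P).
have PW : P = Y2 *m Y1 *m W.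
  transitivity (Y2 *m (P *m A)); first by rewrite -AP.
  rewrite [X in X *m A]PY1 defW -!mulmxA AP; congr (_ *m _).
have [G WGW] : exists G, W *m G *m W = W by exists (pinvmx W); rewrite mulmxKpV.
have PGW : P *m G *m W = P.
  by rewrite [X in X *m G]PW -!(mulmxA (Y2 *m Y1)) WGW -PW.
have WU : P ^t* = W *m (Q *m Y1 ^t*).
  transitivity (P ^t* *m P *m Y1 ^t*).
    by rewrite {1}PY1 !mulmx_ctr trmxCK.
  by rewrite {2}PQ defW !mulmxA.
have WGP : W *m G *m P ^t* = P ^t* by rewrite WU mulmxA WGW.
have XAP : P *m G *m P ^t* *m (A *m P) = P.
  by rewrite -[RHS]PGW defW !mulmxA.
have PE : P = (P *m G *m P ^t*) ^t* *m (A ^t* *m P).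
  transitivity ((W *m G *m P ^t*) ^t*); first by rewrite WGP trmxCK.
  by rewrite defW !mulmx_ctr !trmxCK !mulmxA.
exists (P *m G *m P ^t*); apply/and3P; split.
- apply/eqP; transitivity (P *m G *m W *m G *m P ^t*); last by rewrite PGW.
  by rewrite defW !mulmxA.
- apply/andP; split; apply/colspace_subP.
    by exists (G *m P ^t*); rewrite mulmxA.
  by exists (A *m P); rewrite XAP.
- apply/andP; split; apply/colspace_subP; first by exists (A ^t* *m P).
  by exists ((P *m G) ^t*); rewrite (mulmx_ctr (P *m G)) trmxCK.
Qed.

Lemma core_ep_uniq A X Y : is_core_ep A X -> is_core_ep A Y -> X = Y.
Proof.
move=> /and3P[/eqP XAX /andP[_ /colspace_subP PX] /andP[_ /colspace_subP XP]].
move=> /and3P[/eqP YAY /andP[/colspace_subP YP _] /andP[/colspace_subP PY _]].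
case: PX => U PU; case: XP => V XV; case: YP => S YS; case: PY => T PT.
have XAY : X *m A *m Y = Y by rewrite YS PU !mulmxA XAX.
have XE : X = (T *m V) ^t* *m Y.
  by rewrite -[X in X = _]trmxCK XV PT -mulmxA mulmx_ctr trmxCK.
by rewrite -[RHS]XAY XE -(mulmxA _ Y) -(mulmxA _ (Y *m A)) YAY.
Qed.

Definition core_ep A : 'M[C]_n := xchoose (core_ep_exists A).

Lemma core_epP A : is_core_ep A (core_ep A).
Proof. exact: xchooseP. Qed.

Definition CEPD A : Prop := core_ep A *m drazin A = drazin A *m core_ep A.

End Inverses.

(* Main.v *)
Require Import Defs.
From mathcomp Require Import all_boot all_order all_algebra.
From mathcomp Require Import complex reals.

(* Under either hypothesis the core EP inverse and the Drazin inverse coincide.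
   If X = A^cep commutes with A, then R(A^k) = R(X) and XAX = X give
   X A^(k+1) = A^k, so X is the Drazin inverse.  If A is normal, then so is A^k,
   hence R(A^k) = R((A^k)^* ); as A^D has the row and column spaces of A^k,
   it is the core EP inverse. *)

Local Open Scope ring_scope.
Local Open Scope sesquilinear_scope.
Import GRing.Theory.

(** Expanding one factor [D] as [D *m A *m D] and commuting supplies each further [A]. With [j] the
    index, this puts the row space of [D] inside that of [A ^+ j]. *)
Lemma drazin_powr (C : numClosedFieldType) n (A D : 'M[C]_n) j :
  is_drazin A D -> D = D ^+ j.+1 *m A ^+ j.
Proof.
move=> /and3P[/eqP AD /eqP DAD _]; rewrite !mulmxE in AD DAD *.
elim: j => [|j IHj]; first by rewrite expr0 mulr1 expr1.
transitivity (D ^+ j * (D * A * D) * A ^+ j); first by rewrite DAD -exprSr.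
by rewrite -(mulrA D) AD 2!exprSr exprS !mulrA.
Qed.

Lemma drazin_powl (C : numClosedFieldType) n (A D : 'M[C]_n) j :
  is_drazin A D -> D = A ^+ j *m D ^+ j.+1.
Proof.
move=> AD; rewrite {1}(drazin_powr _ _ _ _ j AD).
case/and3P: AD => /eqP AD _ _; rewrite !mulmxE in AD *.
by apply: commrX; apply/commr_sym/commrX.
Qed.

Lemma ctrmxX (C : numClosedFieldType) n (A : 'M[C]_n) k :
  (A ^+ k) ^t* = (A ^t*) ^+ k.
Proof.
elim: k => [|k IHk]; first by rewrite !expr0 trmx1 map_mx1.
by rewrite exprSr exprS -!mulmxE mulmx_ctr IHk.
Qed.

Lemma normalmxX (C : numClosedFieldType) n (A : 'M[C]_n) k :
  A \is normalmx -> A ^+ k \is normalmx.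
Proof.
move=> /normalmxP AA; apply/normalmxP; rewrite ctrmxX.
rewrite !mulmxE in AA *.
by apply: commrX; apply/commr_sym/commrX.
Qed.

(** By [gram_row], both [P] and [P ^t*] are left multiples of the Hermitian matrix
    [P ^t* *m P = P *m P ^t*]. Taking adjoints makes them right multiples of it, and either factor
    can be put in front. *)
Lemma normalmx_ctrE (C : numClosedFieldType) n (P : 'M[C]_n) :
  P \is normalmx -> (exists M, P = P ^t* *m M) /\ (exists M, P ^t* = P *m M).
Proof.
move=> /normalmxP PP; have [Y PY] := gram_row P.
have [Z] := gram_row (P ^t*); rewrite trmxCK PP => PZ; split.
  exists (P *m Z ^t*); rewrite -[LHS]trmxCK {1}PZ.
  by rewrite !mulmx_ctr trmxCK mulmxA.
exists (P ^t* *m Y ^t*); rewrite {1}PY -PP.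
by rewrite !mulmx_ctr trmxCK mulmxA.
Qed.

Lemma drazin_core_ep (C : numClosedFieldType) n (A : 'M[C]_n) :
  A *m core_ep A = core_ep A *m A -> is_drazin A (core_ep A).
Proof.
move=> AX; have /and3P[/eqP XAX XP _] := core_epP A.
have /andP[_ /colspace_subP[Y PY]] := XP.
apply/and3P; split; apply/eqP=> //.
by rewrite exprS -mulmxE PY !mulmxA XAX.
Qed.

Lemma core_ep_drazin (C : numClosedFieldType) n (A : 'M[C]_n) :
  A \is normalmx -> is_core_ep A (drazin A).
Proof.
move=> nA; have dA := drazinP A; set D := drazin A in dA *.
have /and3P[/eqP AD DAD /eqP DP] := dA; set k := mxindex A in DP.
(* With [D] on the right, taking the adjoint brings [D ^t*] to the front. *)
have PD : A ^+ k = A ^+ k.+1 *m D.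
  rewrite -[LHS]DP; rewrite !mulmxE in AD *.
  by apply: commrX; rewrite /GRing.comm AD.
have [[M PM] [N PN]] := normalmx_ctrE _ _ _ (normalmxX _ _ _ k nA).
apply/and3P; split=> //; rewrite -/k; apply/andP; split; apply/colspace_subP.
- by exists (D ^+ k.+1); exact: drazin_powl.
- by exists (A ^+ k.+1); rewrite DP.
(* Normality enters in these last two inclusions: [M] and [N] trade [A ^+ k] for its adjoint and
   back. *)
- by exists ((A ^+ k.+1) ^t* *m M); rewrite {1}PM {1}PD mulmx_ctr mulmxA.
- exists (N *m (D ^+ k.+1) ^t*).
  by rewrite {1}(drazin_powr _ _ _ _ k dA) mulmx_ctr PN mulmxA.
Qed.

Theorem proposition3p7 (R : realType) (n : nat) (A : 'M[R[i]]_n) :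
  A \is normalmx \/ A *m core_ep A = core_ep A *m A -> CEPD A.
Proof.
move=> hA; suff XD : core_ep A = drazin A by rewrite /CEPD XD.
case: hA => [nA|AX].
  exact: core_ep_uniq (core_epP A) (core_ep_drazin _ _ _ nA).
exact: drazin_uniq (drazin_core_ep _ _ _ AX) (drazinP A).
Qed.
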